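(* Let $R,L,J,m,D_p,V,\omega_g,\omega_n>0$ and $T_m\in\mathbb{R}$, put $\tilde T_m=T_m+D_p(\omega_n-\omega_g)$ and assume $4R\omega_g\tilde T_m\geq -V^2$. Consider the fourth order model of the context, and let $I_f$, $\delta_j(i_f)$, $P_j(i_f)$, $Q_j(i_f)$ and $\phi$ be as in the context. Then the points in $\mathbb{R}^2$ defined by $$S_j(i_f)=\left(P_j(i_f),\,Q_j(i_f)\right),\qquad i_f\in I_f,\ j\in\{1,2\},$$ are on the circle with centre $C$ and radius $r\ge 0$ given by $$C=\left(-\frac{V^2}{2R},\,0\right),\qquad r^2=\frac{V^4+4V^2R\tilde T_m\omega_g}{4R^2}.$$ Define the points $Z,M,O\in\mathbb{R}^2$ as $$Z=(R,\,\omega_gL),\qquad M=-\frac{V^2}{\|Z\|^2}Z,\qquad O=(0,0).$$ Then the distances $CO$ and $CM$ are equal and $$\widehat{O;M;C}=\widehat{C;O;M}=\phi .$$ Moreover, for all $i_f\in I_f$ and $j\in\{1,2\}$, $$S_j(i_f)-M=\frac{V}{\|Z\|}\begin{bmatrix}\cos(\phi-\delta_j(i_f))\\ \sin(\phi-\delta_j(i_f))\end{bmatrix}m\,i_f\,\omega_g .$$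
   Context: Fourth order model: for a fixed constant $i_f\in\mathbb{R}$ (the field current, a parameter), the system with state $\mathbf{x}=[i_d\ i_q\ \omega\ \delta]^\top\in\mathbb{R}^4$ is $$L\dot i_d=-Ri_d+\omega Li_q+V\sin\delta,\qquad L\dot i_q=-\omega Li_d-Ri_q-mi_f\omega+V\cos\delta,$$ $$J\dot\omega=mi_fi_q-D_p\omega+T_m+D_p\omega_n,\qquad \dot\delta=\omega-\omega_g .$$ Angles are regarded modulo $2\pi$. The active power $P$ and reactive power $Q$ at a state are $$P=-V[i_d\sin\delta+i_q\cos\delta],\qquad Q=V[i_q\sin\delta-i_d\cos\delta].$$ Let $p=R/L$, let $\phi\in(0,\pi/2)$ be such that $\tan\phi=\omega_gL/R$, and for $i_f\neq0$ let $$\Lambda(i_f)=-\frac{\tilde T_m}{mi_f}\frac{L\sqrt{p^2+\omega_g^2}}{V}+\frac{mi_f\omega_gp}{V\sqrt{p^2+\omega_g^2}},\qquad I_f=\{i_f>0:\ |\Lambda(i_f)|\le1\}.$$ For $i_f\in I_f$ the model has exactly two equilibrium points $\mathbf{x}_1^e(i_f),\mathbf{x}_2^e(i_f)$ (coinciding if $|\Lambda(i_f)|=1$), whose components are $$\delta_1=\arccos\Lambda(i_f)-\phi,\qquad \delta_2=-\arccos\Lambda(i_f)-\phi,$$ $$i_{dj}^e=-\frac{\tilde T_m\omega_g}{mi_fp}+\frac{V\sin\delta_j}{R},\qquad i_q^e=-\frac{\tilde T_m}{mi_f},\qquad \omega^e=\omega_g\qquad(j\in\{1,2\}),$$ where $\arccos:[-1,1]\to[0,\pi]$.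 Denote by $\delta_j(i_f)$ the $\delta$-component of $\mathbf{x}_j^e(i_f)$ and by $P_j(i_f)$, $Q_j(i_f)$ the values of $P$, $Q$ at $\mathbf{x}_j^e(i_f)$. For $X,Y,Z'\in\mathbb{R}^2$, $\widehat{X;Y;Z'}$ denotes the angle from the vector $X-Y$ to the vector $Z'-Y$, measured counterclockwise. $\|\cdot\|$ is the Euclidean norm; vectors and pairs of coordinates are identified. *)

(* Defs.v *)
From Stdlib Require Import Reals Lra Psatz ZArith.
From Coquelicot Require Import Coquelicot.
Open Scope R_scope.

Record generator := Generator {
  Rs : R;  (* the resistance, renamed to avoid a clash with the type of reals *)
  L : R; J : R; m : R; Dp : R; V : R; wg : R; wn : R; Tm : R }.

(* No sign condition on [Tm]. *)
Definition positive_parameters (g : generator) : Prop :=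
  0 < Rs g /\ 0 < L g /\ 0 < J g /\ 0 < m g /\ 0 < Dp g /\
  0 < V g /\ 0 < wg g /\ 0 < wn g.

Definition Tm_tilde (g : generator) : R := Tm g + Dp g * (wn g - wg g).

(* [delta] is a real representative of an angle modulo [2 * PI]. *)
Record state := State { i_d : R; i_q : R; omega : R; delta : R }.

(* The time derivative of the state, for the constant field current [i_f]. *)
Definition vector_field (g : generator) (i_f : R) (x : state) : state :=
  State
    ((- Rs g * i_d x + omega x * L g * i_q x + V g * sin (delta x)) / L g)
    ((- omega x * L g * i_d x - Rs g * i_q x - m g * i_f * omega x
       + V g * cos (delta x)) / L g)
    ((m g * i_f * i_q x - Dp g * omega x + Tm g + Dp g * wn g) / J g)
    (omega x - wg g).

Definition equilibrium (g : generator) (i_f : R) (x : state) : Prop :=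
  vector_field g i_f x = State 0 0 0 0.

Definition active_power (g : generator) (x : state) : R :=
  - V g * (i_d x * sin (delta x) + i_q x * cos (delta x)).

Definition reactive_power (g : generator) (x : state) : R :=
  V g * (i_q x * sin (delta x) - i_d x * cos (delta x)).

Definition p (g : generator) : R := Rs g / L g.

Definition Lambda (g : generator) (i_f : R) : R :=
  - (Tm_tilde g / (m g * i_f)) * (L g * sqrt (p g ^ 2 + wg g ^ 2) / V g)
  + m g * i_f * wg g * p g / (V g * sqrt (p g ^ 2 + wg g ^ 2)).

Definition I_f (g : generator) (i_f : R) : Prop :=
  0 < i_f /\ Rabs (Lambda g i_f) <= 1.

(* The labels j = 1, 2 of the two equilibrium points. *)
Inductive branch := first | second.

Definition delta_eq (g : generator) (phi i_f : R) (j : branch) : R :=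
  match j with
  | first => acos (Lambda g i_f) - phi
  | second => - acos (Lambda g i_f) - phi
  end.

Definition x_eq (g : generator) (phi i_f : R) (j : branch) : state :=
  State
    (- (Tm_tilde g * wg g / (m g * i_f * p g))
       + V g * sin (delta_eq g phi i_f j) / Rs g)
    (- (Tm_tilde g / (m g * i_f)))
    (wg g)
    (delta_eq g phi i_f j).

Definition P_eq (g : generator) (phi i_f : R) (j : branch) : R :=
  active_power g (x_eq g phi i_f j).

Definition Q_eq (g : generator) (phi i_f : R) (j : branch) : R :=
  reactive_power g (x_eq g phi i_f j).

Definition S_pt (g : generator) (phi i_f : R) (j : branch) : R * R :=
  (P_eq g phi i_f j, Q_eq g phi i_f j).

Definition Z_pt (g : generator) : R * R := (Rs g, wg g * L g).

(* Coquelicot's [norm] on the product [R * R] is the Euclidean norm, see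
   [norm_pair]. *)
Definition M_pt (g : generator) : R * R :=
  scal (- (V g ^ 2 / norm (Z_pt g) ^ 2)) (Z_pt g).

Definition C_pt (g : generator) : R * R := (- (V g ^ 2 / (2 * Rs g)), 0).

Definition O_pt : R * R := (0, 0).

Definition dot (u v : R * R) : R := fst u * fst v + snd u * snd v.
Definition det (u v : R * R) : R := fst u * snd v - snd u * fst v.

(* The counterclockwise angle from [u] to [v], in [0, 2 * PI); meaningful only
   for nonzero vectors, see [ccw_angle_spec]. *)
Definition ccw_angle (u v : R * R) : R :=
  let a := acos (dot u v / (norm u * norm v)) in
  if Rle_dec 0 (det u v) then a else 2 * PI - a.

Definition angle (X Y W : R * R) : R := ccw_angle (minus X Y) (minus W Y).

Lemma norm_pair (u : R * R) : norm u = sqrt (fst u ^ 2 + snd u ^ 2).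
Proof.
change (norm u) with (sqrt (Rabs (fst u) ^ 2 + Rabs (snd u) ^ 2)).
now rewrite !pow2_abs.
Qed.

Lemma norm_pair_pos (u : R * R) : u <> (0, 0) -> 0 < norm u.
Proof.
intros hu; rewrite norm_pair; apply sqrt_lt_R0.
destruct u as [a b]; simpl fst; simpl snd.
assert (h : a <> 0 \/ b <> 0).
{ destruct (Req_dec a 0), (Req_dec b 0); subst; auto; now contradict hu. }
destruct h; nra.
Qed.

Lemma norm_pair_sqr (u : R * R) : norm u ^ 2 = fst u ^ 2 + snd u ^ 2.
Proof. rewrite norm_pair; apply pow2_sqrt; nra. Qed.

(* [v / |v|] is [u / |u|] rotated counterclockwise by [ccw_angle u v]. *)
Lemma ccw_angle_spec (u v : R * R) : u <> (0, 0) -> v <> (0, 0) ->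
  let t := ccw_angle u v in
  0 <= t < 2 * PI /\
  scal (norm u) v =
    scal (norm v) (cos t * fst u - sin t * snd u, sin t * fst u + cos t * snd u).
Proof.
intros hu hv t.
assert (pu := norm_pair_pos u hu); assert (pv := norm_pair_pos v hv).
assert (su := norm_pair_sqr u); assert (sv := norm_pair_sqr v).
set (c := dot u v / (norm u * norm v)).
assert (hc : dot u v = c * (norm u * norm v)) by (unfold c; field; lra).
assert (lagr : dot u v ^ 2 + det u v ^ 2 = norm u ^ 2 * norm v ^ 2).
{ rewrite su, sv; unfold dot, det; ring. }
set (s := det u v / (norm u * norm v)).
assert (hs : det u v = s * (norm u * norm v)) by (unfold s; field; lra).
assert (puv : 0 < norm u * norm v) by nra.
assert (cs : c ^ 2 + s ^ 2 = 1).
{ rewrite hc, hs in lagr.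
  apply Rmult_eq_reg_r with ((norm u * norm v) ^ 2); nra. }
assert (bc : -1 <= c <= 1) by nra.
assert (ct : cos t = c /\ sin t = s /\ 0 <= t < 2 * PI).
{ assert (ba := acos_bound c). assert (PIp := PI_RGT_0).
  assert (cc := cos_acos c bc). assert (sc := sin_acos c bc).
  unfold t, ccw_angle; fold c; destruct (Rle_dec 0 (det u v)) as [d | d].
  - assert (0 <= s) by (apply Rmult_le_reg_r with (norm u * norm v); lra).
    split; [exact cc | split; [ | lra]].
    rewrite sc; replace (1 - c²) with (s ^ 2) by (unfold Rsqr; lra).
    now rewrite sqrt_pow2.
  - assert (s < 0) by nra.
    replace (2 * PI - acos c) with (- acos c + 2 * INR 1 * PI) by (simpl; ring).
    rewrite cos_period, sin_period, cos_neg, sin_neg.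
    split; [exact cc | split].
    + rewrite sc; replace (1 - c²) with ((- s) ^ 2) by (unfold Rsqr; lra).
      rewrite sqrt_pow2; lra.
    + simpl INR; split; [lra | ].
      destruct (Req_dec (acos c) 0) as [e | e]; [ | lra].
      rewrite e, cos_0 in cc; nra. }
destruct ct as [-> [-> bt]]; split; [exact bt | ].
destruct u as [a b], v as [x y].
unfold dot, det in hc, hs; simpl fst in *; simpl snd in *.
change ((norm (a, b) * x, norm (a, b) * y) =
  (norm (x, y) * (c * a - s * b), norm (x, y) * (s * a + c * b))).
apply f_equal2; apply Rmult_eq_reg_l with (norm (a, b)); try lra.
- transitivity (norm (a, b) ^ 2 * x); [ring | rewrite su].
  replace (norm (a, b) * (norm (x, y) * (c * a - s * b)))
    with (c * (norm (a, b) * norm (x, y)) * a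
          - s * (norm (a, b) * norm (x, y)) * b) by ring.
  rewrite <- hc, <- hs; ring.
- transitivity (norm (a, b) ^ 2 * y); [ring | rewrite su].
  replace (norm (a, b) * (norm (x, y) * (s * a + c * b)))
    with (s * (norm (a, b) * norm (x, y)) * a
          + c * (norm (a, b) * norm (x, y)) * b) by ring.
  rewrite <- hc, <- hs; ring.
Qed.

Lemma cos_eq_iff (x y : R) : cos x = cos y <->
  exists k : Z, x = y + 2 * IZR k * PI \/ x = - y + 2 * IZR k * PI.
Proof.
split.
- intros h.
  assert (h2 := form2 x y).
  replace (cos x - cos y) with 0 in h2 by lra.
  assert (h3 : sin ((x - y) / 2) = 0 \/ sin ((x + y) / 2) = 0).
  { apply Rmult_integral; lra. }
  destruct h3 as [h3 | h3]; apply sin_eq_0_0 in h3; destruct h3 as [k hk];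
    exists k; [left | right]; lra.
- assert (per : forall z (k : Z), cos (z + 2 * IZR k * PI) = cos z).
  { intros z k; rewrite cos_plus.
    replace (2 * IZR k * PI) with (2 * (IZR k * PI)) by ring.
    rewrite cos_2a_sin, sin_2a, (sin_eq_0_1 (IZR k * PI)); [ring | now exists k]. }
  intros [k [-> | ->]]; rewrite per; [easy | apply cos_neg].
Qed.

(* [x_eq g phi i_f first] and [x_eq g phi i_f second] are exactly the equilibrium
   points of the model, up to multiples of [2 * PI] in [delta]. *)
Lemma equilibrium_iff (g : generator) (phi i_f : R) (x : state) :
  positive_parameters g -> 0 < phi < PI / 2 -> tan phi = wg g * L g / Rs g ->
  I_f g i_f ->
  equilibrium g i_f x <->
  exists (j : branch) (k : Z),
    let e := x_eq g phi i_f j in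
    x = State (i_d e) (i_q e) (omega e) (delta e + 2 * IZR k * PI).
Proof.
intros [hR [hL [hJ [hm [hD [hV [hw hn]]]]]]] hphi htan [hi hLam].
set (q := sqrt (p g ^ 2 + wg g ^ 2)).
assert (hp : 0 < p g) by (apply Rdiv_lt_0_compat; lra).
assert (hRp : Rs g = p g * L g) by (unfold p; field; lra).
assert (hq : 0 < q) by (apply sqrt_lt_R0; nra).
assert (hq2 : q ^ 2 = p g ^ 2 + wg g ^ 2) by (apply pow2_sqrt; nra).
assert (hc : 0 < cos phi) by (apply cos_gt_0; lra).
assert (hs : sin phi * p g = wg g * cos phi).
{ replace (sin phi) with (tan phi * cos phi) by (unfold tan; field; lra).
  rewrite htan, hRp; field; lra. }
assert (hcs := sin2_cos2 phi); unfold Rsqr in hcs.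
assert (hcq : cos phi * q = p g).
{ apply Rsqr_inj; [nra | lra | unfold Rsqr].
  transitivity (cos phi ^ 2 * q ^ 2); [ring | rewrite hq2].
  transitivity ((cos phi * p g) ^ 2 + (wg g * cos phi) ^ 2); [ring | ].
  rewrite <- hs.
  transitivity ((sin phi * sin phi + cos phi * cos phi) * (p g * p g));
    [ring | rewrite hcs; ring]. }
assert (hsq : sin phi * q = wg g).
{ apply Rmult_eq_reg_r with (p g); [ | lra].
  transitivity (sin phi * p g * q); [ring | rewrite hs].
  rewrite <- hcq; ring. }
assert (key : forall d, cos (d + phi) = Lambda g i_f <->
  exists (j : branch) (k : Z), d = delta_eq g phi i_f j + 2 * IZR k * PI).
{ intros d; rewrite <- (cos_acos (Lambda g i_f)) by now apply Rabs_le_between.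
  rewrite cos_eq_iff; split.
  - intros [k [h | h]]; [exists first | exists second]; exists k;
      unfold delta_eq; lra.
  - intros [[|] [k h]]; exists k; unfold delta_eq in h; [left | right]; lra. }
assert (main : equilibrium g i_f x <->
  cos (delta x + phi) = Lambda g i_f /\
  i_d x = - (Tm_tilde g * wg g / (m g * i_f * p g)) + V g * sin (delta x) / Rs g /\
  i_q x = - (Tm_tilde g / (m g * i_f)) /\ omega x = wg g).
{ destruct x as [a b w d]; unfold equilibrium, vector_field; simpl.
  assert (third : forall y, y = - (Tm_tilde g / (m g * i_f)) ->
    m g * i_f * y - Dp g * wg g + Tm g + Dp g * wn g = 0).
  { intros y ->; unfold Tm_tilde; field; lra. }
  assert (second : forall s : R, s = V g * sin d ->
    (- wg g * L g * (- (Tm_tilde g * wg g / (m g * i_f * p g)) + s / Rs g)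
     - Rs g * - (Tm_tilde g / (m g * i_f)) - m g * i_f * wg g + V g * cos d)
    = V g * q / p g * (cos (d + phi) - Lambda g i_f)).
  { intros s ->; unfold Lambda; fold q; rewrite cos_plus.
    replace (cos phi) with (p g / q) by (rewrite <- hcq; field; lra).
    replace (sin phi) with (wg g / q) by (rewrite <- hsq; field; lra).
    rewrite hRp.
    transitivity ((L g * q ^ 2) * (Tm_tilde g / (m g * i_f * p g))
      - wg g / p g * V g * sin d - m g * i_f * wg g + V g * cos d);
      [rewrite hq2 | ]; field; lra. }
  split.
  - intros h; injection h as h1 h2 h3 h4.
    assert (w = wg g) by lra; subst w.
    assert (z : forall n c, 0 < c -> n / c = 0 -> n = 0).
    { intros n c hc' e; replace n with (n / c * c) by (field; lra).
      rewrite e; ring. }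
    apply z in h1; [ | easy]; apply z in h2; [ | easy]; apply z in h3; [ | easy].
    assert (hb : b = - (Tm_tilde g / (m g * i_f))).
    { apply Rmult_eq_reg_l with (m g * i_f); [ | nra].
      assert (t := third _ eq_refl); lra. }
    assert (ha : a = - (Tm_tilde g * wg g / (m g * i_f * p g))
                     + V g * sin d / Rs g).
    { apply Rmult_eq_reg_l with (Rs g); [ | lra].
      transitivity (wg g * L g * b + V g * sin d); [lra | ].
      rewrite hb, hRp; field; lra. }
    repeat split; auto.
    rewrite ha, hb in h2.
    specialize (second _ eq_refl).
    assert (e : V g * q / p g * (cos (d + phi) - Lambda g i_f) = 0) by lra.
    apply Rmult_integral in e; destruct e as [e | e]; [ | lra].
    assert (0 < V g * q / p g) by (apply Rdiv_lt_0_compat; nra); lra.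
  - intros [hd [ha [hb hw']]]; subst w.
    rewrite (third b hb), ha, hb.
    rewrite (second _ eq_refl), hd.
    f_equal; [rewrite hRp | | | ]; field; lra. }
rewrite main, key; unfold x_eq; simpl.
assert (sinper : forall j (k : Z),
  sin (delta_eq g phi i_f j + 2 * IZR k * PI) = sin (delta_eq g phi i_f j)).
{ intros j k; rewrite sin_plus.
  replace (2 * IZR k * PI) with (2 * (IZR k * PI)) by ring.
  rewrite cos_2a_sin, sin_2a, (sin_eq_0_1 (IZR k * PI)); [ring | now exists k]. }
split.
- intros [[j [k hd]] [ha [hb hw']]]; exists j, k.
  destruct x as [a b w d]; simpl in *; subst d.
  rewrite sinper in ha; now subst.
- intros [j [k ->]]; simpl; rewrite sinper; repeat split; now exists j, k.
Qed.

(* Main.v *)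
(** In polar form [Z = |Z| (cos phi, sin phi)], so that [M = - V^2 cos phi / R
    (cos phi, sin phi)] and [C - M = V^2 / (2 R) (cos (2 phi), sin (2 phi))];
    the distances and angles are read off these directions.  The relation
    [cos (delta_j + phi) = Lambda] eliminates [Tm_tilde] from [P_j] and [Q_j],
    which turns [S_j - M] into polar form; expanding [|(S_j - M) + (M - C)|^2]
    and using the same relation once more, all terms in [i_f] cancel. *)
Require Import Defs.
From Stdlib Require Import Reals Lra.
From Coquelicot Require Import Coquelicot.
Open Scope R_scope.

(** The radius [a] may be negative: [M_polar] uses this to keep the direction [phi] of [Z]. *)
Definition polar (a t : R) : R * R := (a * cos t, a * sin t).

Lemma norm_polar (a t : R) : 0 <= a -> norm (polar a t) = a.
Proof.
intros ha; rewrite norm_pair; simpl fst; simpl snd.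
replace ((a * cos t) ^ 2 + (a * sin t) ^ 2) with (a ^ 2).
- now apply sqrt_pow2.
- transitivity (a ^ 2 * (Rsqr (sin t) + Rsqr (cos t)));
    [rewrite sin2_cos2 | unfold Rsqr]; ring.
Qed.

(** By the subtraction formulas, [dot] and [det] are [a * b * cos t] and [a * b * sin t]. For [t] in
    [[0, PI]] the determinant is nonnegative, so [ccw_angle] takes its [acos] branch, where
    [acos (cos t) = t]. *)
Lemma ccw_angle_polar (a b s t : R) : 0 < a -> 0 < b -> 0 <= t <= PI ->
  ccw_angle (polar a s) (polar b (s + t)) = t.
Proof.
intros ha hb ht.
assert (hdot : dot (polar a s) (polar b (s + t)) = a * b * cos t).
{ replace (cos t) with (cos (s + t - s)) by (f_equal; ring).
  unfold dot, polar; simpl; rewrite (cos_minus (s + t)); ring. }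
assert (hdet : det (polar a s) (polar b (s + t)) = a * b * sin t).
{ replace (sin t) with (sin (s + t - s)) by (f_equal; ring).
  unfold det, polar; simpl; rewrite (sin_minus (s + t)); ring. }
unfold ccw_angle; rewrite hdot, hdet, !norm_polar by lra.
replace (a * b * cos t / (a * b)) with (cos t) by (field; lra).
rewrite acos_cos by easy.
destruct (Rle_dec 0 (a * b * sin t)) as [h | h]; [easy | ].
contradict h; apply Rmult_le_pos; [nra | apply sin_ge_0; lra].
Qed.

Section Geometry.

Variables (g : generator) (phi : R).
Hypothesis hg : positive_parameters g.
Hypothesis hphi : 0 < phi < PI / 2.
Hypothesis htan : tan phi = wg g * L g / Rs g.

Lemma cos_phi_pos : 0 < cos phi.
Proof. apply cos_gt_0; lra. Qed.

Lemma wgL_eq : wg g * L g = Rs g * sin phi / cos phi.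
Proof.
assert (hc := cos_phi_pos); destruct hg as [hR _].
transitivity (Rs g * tan phi); [rewrite htan | unfold tan]; field; lra.
Qed.

Lemma sin_phi_sqr : sin phi ^ 2 = 1 - cos phi ^ 2.
Proof. assert (h := sin2_cos2 phi); unfold Rsqr in h; lra. Qed.

Lemma Z_polar : Z_pt g = polar (Rs g / cos phi) phi.
Proof.
assert (hc := cos_phi_pos).
unfold Z_pt, polar; rewrite wgL_eq; f_equal; field; lra.
Qed.

Lemma norm_Z : norm (Z_pt g) = Rs g / cos phi.
Proof.
assert (hc := cos_phi_pos); destruct hg as [hR _].
rewrite Z_polar; apply norm_polar, Rlt_le, Rdiv_lt_0_compat; lra.
Qed.

Lemma M_polar : M_pt g = polar (- (V g ^ 2 * cos phi / Rs g)) phi.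
Proof.
assert (hc := cos_phi_pos); destruct hg as [hR _].
unfold M_pt; rewrite norm_Z, Z_polar.
apply injective_projections; simpl; unfold scal; simpl; unfold mult; simpl;
  field; lra.
Qed.

(** Double-angle formulas. The sum [phi + phi] is left unsimplified to fit [ccw_angle_polar] with
    base direction [phi] and turn [phi]. *)
Lemma C_minus_M_polar :
  minus (C_pt g) (M_pt g) = polar (V g ^ 2 / (2 * Rs g)) (phi + phi).
Proof.
destruct hg as [hR _].
rewrite M_polar; unfold C_pt, polar; rewrite cos_plus, sin_plus.
assert (hs := sin_phi_sqr).
apply injective_projections; simpl; unfold minus, plus, opp; simpl.
- replace (sin phi * sin phi) with (1 - cos phi ^ 2) by lra; field; lra.
- field; lra.
Qed.

Lemma V2_div_R_pos : 0 < V g ^ 2 / (2 * Rs g) /\ 0 < V g ^ 2 * cos phi / Rs g.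
Proof.
assert (hc := cos_phi_pos); destruct hg as [hR [_ [_ [_ [_ [hV _]]]]]].
assert (0 < V g ^ 2) by nra.
split; apply Rdiv_lt_0_compat; nra.
Qed.

Lemma O_minus_C_polar : minus O_pt (C_pt g) = polar (V g ^ 2 / (2 * Rs g)) 0.
Proof.
unfold O_pt, C_pt, polar; rewrite cos_0, sin_0.
apply injective_projections; simpl; unfold minus, plus, opp; simpl; ring.
Qed.

Lemma dist_O_C : norm (minus O_pt (C_pt g)) = norm (minus (M_pt g) (C_pt g)).
Proof.
assert (h := V2_div_R_pos).
transitivity (norm (minus (C_pt g) (M_pt g))).
- rewrite O_minus_C_polar, C_minus_M_polar, !norm_polar; lra.
- rewrite <- (opp_minus (M_pt g) (C_pt g)).
  exact (norm_opp (minus (M_pt g) (C_pt g))).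
Qed.

Lemma angle_O_M_C : angle O_pt (M_pt g) (C_pt g) = phi.
Proof.
assert (h := V2_div_R_pos).
unfold angle; rewrite C_minus_M_polar.
(* Negating [M] makes the radius in [M_polar] positive. *)
replace (minus O_pt (M_pt g)) with (polar (V g ^ 2 * cos phi / Rs g) phi).
- apply ccw_angle_polar; lra.
- rewrite M_polar; unfold O_pt, polar.
  apply injective_projections; simpl; unfold minus, plus, opp; simpl; ring.
Qed.

Lemma angle_C_O_M : angle (C_pt g) O_pt (M_pt g) = phi.
Proof.
assert (h := V2_div_R_pos).
unfold angle.
(* [C] lies on the negative horizontal axis; the half turn [PI] also absorbs the negative radius of
   [M]. *)
replace (minus (C_pt g) O_pt) with (polar (V g ^ 2 / (2 * Rs g)) PI).
- replace (minus (M_pt g) O_pt)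
    with (polar (V g ^ 2 * cos phi / Rs g) (PI + phi)).
  + apply ccw_angle_polar; lra.
  + rewrite M_polar; unfold O_pt, polar.
    rewrite (Rplus_comm PI), neg_cos, neg_sin.
    apply injective_projections; simpl; unfold minus, plus, opp; simpl; ring.
- unfold O_pt, C_pt, polar; rewrite cos_PI, sin_PI.
  apply injective_projections; simpl; unfold minus, plus, opp; simpl; ring.
Qed.

(** The square root in [Lambda] is [|Z| / L], that is [Rs g / (L g * cos phi)]. *)
Lemma Lambda_eq (i_f : R) : 0 < i_f ->
  Lambda g i_f = - (Tm_tilde g / (m g * i_f)) * (Rs g / (V g * cos phi))
                 + m g * i_f * wg g * cos phi / V g.
Proof.
intros hi; assert (hc := cos_phi_pos).
destruct hg as [hR [hL [_ [hm [_ [hV _]]]]]].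
unfold Lambda.
replace (sqrt (p g ^ 2 + wg g ^ 2)) with (Rs g / (L g * cos phi)).
- unfold p; field; repeat split; lra.
- assert (0 < L g * cos phi) by nra.
  rewrite <- (sqrt_pow2 (Rs g / (L g * cos phi)))
    by (apply Rlt_le, Rdiv_lt_0_compat; lra).
  f_equal.
  replace (wg g) with (Rs g * sin phi / cos phi / L g)
    by (rewrite <- wgL_eq; field; lra).
  transitivity (Rs g ^ 2 / L g ^ 2 + Rs g ^ 2 * (sin phi ^ 2) / (cos phi * L g) ^ 2);
    [rewrite sin_phi_sqr | ]; unfold p; field; lra.
Qed.

Lemma cos_delta_eq (i_f : R) (j : branch) : I_f g i_f ->
  cos (delta_eq g phi i_f j + phi) = Lambda g i_f.
Proof.
intros [_ hL]; apply Rabs_le_between in hL.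
destruct j; unfold delta_eq.
- replace (acos (Lambda g i_f) - phi + phi) with (acos (Lambda g i_f)) by ring.
  now apply cos_acos.
- replace (- acos (Lambda g i_f) - phi + phi) with (- acos (Lambda g i_f)) by ring.
  rewrite cos_neg; now apply cos_acos.
Qed.

(** [Lambda_eq] solved for the torque term, with [Lambda] replaced by the cosine. This is all that
    is needed about [delta_eq] afterwards, so both branches are treated at once as an arbitrary
    angle [d]. *)
Lemma Tm_tilde_eq (i_f : R) (j : branch) : I_f g i_f ->
  Tm_tilde g / (m g * i_f) =
  cos phi / Rs g * (m g * i_f * wg g * cos phi
                    - V g * cos (delta_eq g phi i_f j + phi)).
Proof.
intros h; assert (hc := cos_phi_pos); assert (hi := proj1 h).
destruct hg as [hR [_ [_ [hm [_ [hV _]]]]]].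
rewrite cos_delta_eq, Lambda_eq by easy; field; repeat split; lra.
Qed.

Lemma S_minus_M_polar (i_f : R) (j : branch) : I_f g i_f ->
  minus (S_pt g phi i_f j) (M_pt g) =
  polar (V g * cos phi / Rs g * (m g * i_f * wg g))
        (phi - delta_eq g phi i_f j).
Proof.
intros h; assert (hc := cos_phi_pos); assert (hi := proj1 h).
assert (hT := Tm_tilde_eq i_f j h); revert hT.
assert (hs := sin_phi_sqr).
rewrite M_polar.
unfold S_pt, P_eq, Q_eq, active_power, reactive_power, x_eq, polar; simpl.
generalize (delta_eq g phi i_f j); intros d hT.
destruct hg as [hR [hL [_ [hm [_ [hV _]]]]]].
(* Here [wg g / p g] is [tan phi]. *)
replace (Tm_tilde g * wg g / (m g * i_f * p g))
  with (Tm_tilde g / (m g * i_f) * sin phi / cos phi).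
2: { transitivity (Tm_tilde g / (m g * i_f) * (Rs g * sin phi / cos phi) / Rs g);
       [ | rewrite <- wgL_eq; unfold p]; field; repeat split; lra. }
assert (hd := sin2_cos2 d); unfold Rsqr in hd.
rewrite hT, cos_minus, sin_minus, cos_plus.
(* Both differences are combinations of [sin^2 + cos^2 - 1 = 0] at [d] and [phi]. *)
apply injective_projections; simpl; unfold minus, plus, opp; simpl;
  apply Rminus_diag_uniq.
- transitivity (- (V g ^ 2 / Rs g) *
    (cos phi ^ 2 * (sin d * sin d + cos d * cos d - 1)
     - sin d ^ 2 * (sin phi ^ 2 - (1 - cos phi ^ 2)))).
  + field; lra.
  + rewrite hd, hs; ring.
- transitivity (- (V g ^ 2 / Rs g) *
    (cos phi * sin phi * (sin d * sin d + cos d * cos d - 1)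
     - sin d * cos d * (sin phi ^ 2 - (1 - cos phi ^ 2)))).
  + field; lra.
  + rewrite hd, hs; ring.
Qed.

Lemma norm_S_minus_C_sqr (i_f : R) (j : branch) : I_f g i_f ->
  norm (minus (S_pt g phi i_f j) (C_pt g)) ^ 2 =
  (V g ^ 4 + 4 * V g ^ 2 * Rs g * Tm_tilde g * wg g) / (4 * Rs g ^ 2).
Proof.
intros h; assert (hc := cos_phi_pos); assert (hi := proj1 h).
assert (hT := Tm_tilde_eq i_f j h).
replace (minus (S_pt g phi i_f j) (C_pt g))
  with (minus (minus (S_pt g phi i_f j) (M_pt g)) (minus (C_pt g) (M_pt g))).
2: { generalize (S_pt g phi i_f j) (M_pt g) (C_pt g); intros [a b] [x y] [c d].
     apply injective_projections; simpl; unfold minus, plus, opp; simpl; ring. }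
rewrite S_minus_M_polar, C_minus_M_polar, norm_pair_sqr by easy.
revert hT; generalize (delta_eq g phi i_f j); intros d hT.
destruct hg as [hR [_ [_ [hm [_ [hV _]]]]]].
replace (Tm_tilde g) with (Tm_tilde g / (m g * i_f) * (m g * i_f))
  by (field; lra).
rewrite hT; set (k := V g * cos phi / Rs g * (m g * i_f * wg g)).
set (c := V g ^ 2 / (2 * Rs g)).
(* Law of cosines for two vectors of lengths [k] and [c]; the angle between them is [d + phi], whose
   cosine is the one occurring in [hT]. *)
transitivity
  (k ^ 2 * (Rsqr (sin (phi - d)) + Rsqr (cos (phi - d)))
   + c ^ 2 * (Rsqr (sin (phi + phi)) + Rsqr (cos (phi + phi)))
   - 2 * k * c * cos (phi + phi - (phi - d))).
- rewrite (cos_minus (phi + phi)); simpl; unfold minus, plus, opp; simpl.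
  unfold Rsqr; ring.
- rewrite !sin2_cos2; unfold k, c.
  replace (phi + phi - (phi - d)) with (d + phi) by ring.
  field; lra.
Qed.

End Geometry.

Theorem mainTheorem1 (g : generator) (phi : R)
  (hg : positive_parameters g)
  (hT : 4 * Rs g * wg g * Tm_tilde g >= - V g ^ 2)
  (hphi : 0 < phi < PI / 2)
  (htan : tan phi = wg g * L g / Rs g) :
  (exists r : R,
     0 <= r /\
     r ^ 2 = (V g ^ 4 + 4 * V g ^ 2 * Rs g * Tm_tilde g * wg g)
             / (4 * Rs g ^ 2) /\
     forall (i_f : R) (j : branch), I_f g i_f ->
       norm (minus (S_pt g phi i_f j) (C_pt g)) = r) /\
  norm (minus O_pt (C_pt g)) = norm (minus (M_pt g) (C_pt g)) /\
  angle O_pt (M_pt g) (C_pt g) = phi /\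
  angle (C_pt g) O_pt (M_pt g) = phi /\
  (forall (i_f : R) (j : branch), I_f g i_f ->
     minus (S_pt g phi i_f j) (M_pt g) =
     scal (V g / norm (Z_pt g) * (m g * i_f * wg g))
       (cos (phi - delta_eq g phi i_f j), sin (phi - delta_eq g phi i_f j))).
Proof.
split; [ | split; [ | split; [ | split]]].
- set (r2 := (V g ^ 4 + 4 * V g ^ 2 * Rs g * Tm_tilde g * wg g)
             / (4 * Rs g ^ 2)).
  assert (h0 : 0 <= r2).
  { destruct hg as [hR _].
    (* The second factor is nonnegative exactly by [hT]. *)
    replace r2 with (V g ^ 2 * (4 * Rs g * wg g * Tm_tilde g + V g ^ 2)
                     / (4 * Rs g ^ 2)) by (unfold r2; field; lra).
    apply Rdiv_le_0_compat; nra. }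
  exists (sqrt r2); repeat split.
  + apply sqrt_pos.
  + now apply pow2_sqrt.
  + intros i_f j h.
    rewrite <- (sqrt_pow2 (norm (minus (S_pt g phi i_f j) (C_pt g))))
      by apply norm_ge_0.
    now rewrite norm_S_minus_C_sqr.
- now apply dist_O_C with phi.
- now apply angle_O_M_C.
- now apply angle_C_O_M.
- intros i_f j h.
  assert (hc := cos_phi_pos phi hphi); assert (hR := proj1 hg).
  rewrite S_minus_M_polar, norm_Z with (phi := phi) by easy.
  replace (V g / (Rs g / cos phi)) with (V g * cos phi / Rs g)
    by (field; lra).
  reflexivity.
Qed.
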